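(* Let $p>1$, $\lambda>0$, $k>0$, $h>0$, and let $m\ge 0$ be an integer. Assume that $u_{ij}^m>0$ for all grid points $(i,j)$ at time level $m$. Then the values $u_{ij}^{m+1}$ produced from $(u_{ij}^m)$ by the nonstandard finite difference (NSFD) scheme $$u_{ij}^{m+1} = \frac{u_{ij}^m + \lambda r_\phi \big(u_{i+1,j}^m\Phi_{p,i+1,j}^m + u_{i-1,j}^m\Phi_{p,i-1,j}^m + u_{i,j+1}^m\Phi_{p,i,j+1}^m + u_{i,j-1}^m\Phi_{p,i,j-1}^m\big) + \phi(k) f^+(u_{ij}^m)}{1 + q_{-,ij}^m + 4\lambda r_\phi \Phi_{p,ij}^m},$$ with the discrete homogeneous Neumann boundary conditions, satisfy $u_{ij}^{m+1}>0$ for all grid points $(i,j)$.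
   Context: Grid and notation. The grid points are $(x_i,y_j)$, $i=0,\dots,N_x$, $j=0,\dots,N_y$, with uniform mesh size $h$ in both directions; $k$ is the time step, $t_m=mk$, and $u_{ij}^m$ denotes the approximation at $(t_m,x_i,y_j)$. Define $\Phi_p(y)=y^{p-2}$ for $y>0$; at $y=0$ use $\Phi_p(0)=0$ if $p\neq 2$ and $\Phi_2\equiv 1$. Set $$D_{h,x}^0u_{ij}^m=\frac{u_{i+1,j}^m-u_{i-1,j}^m}{2h},\quad D_{h,y}^0u_{ij}^m=\frac{u_{i,j+1}^m-u_{i,j-1}^m}{2h},\quad \Phi_{p,ij}^m=\Phi_p\Big(\sqrt{(D_{h,x}^0u_{ij}^m)^2+(D_{h,y}^0u_{ij}^m)^2}\Big).$$ Discrete homogeneous Neumann boundary conditions (ghost values by reflection): $u_{-1,j}^m=u_{1,j}^m$ and $u_{N_x+1,j}^m=u_{N_x-1,j}^m$ for $0\le j\le N_y$; $u_{i,-1}^m=u_{i,1}^m$ and $u_{i,N_y+1}^m=u_{i,N_y-1}^m$ for $0\le i\le N_x$; $u_{-1,-1}^m=u_{1,1}^m$, $u_{N_x+1,-1}^m=u_{N_x-1,1}^m$, $u_{-1,N_y+1}^m=u_{1,N_y-1}^m$, $u_{N_x+1,N_y+1}^m=u_{N_x-1,N_y-1}^m$. The values $\Phi_{p}^m$ at ghost points are obtained by the same reflection. The denominator function $\phi$ satisfies $\phi(k)>0$ for all $k>0$ and $\phi(k)=k+\mathcal{O}(k^2)$. The generalized mesh ratio is $r_\phi=\phi(k)/h^2$.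 The function $f$ is a sufficiently smooth real function satisfying the standing condition $f(s)\le Ls$ for all $s\ge 0$, for some constant $L>0$. Its positive and negative parts are $f^+=\max(f,0)\ge 0$ and $f^-=\max(-f,0)\ge 0$, so $f=f^+-f^-$. Finally $q_{-,ij}^m=\phi(k)f^-(u_{ij}^m)/u_{ij}^m$. *)

(* Defs.v *)
From mathcomp Require Import all_boot all_order all_algebra.
From mathcomp Require Import all_classical all_reals all_analysis.
Set Implicit Arguments.
Unset Strict Implicit.
Unset Printing Implicit Defensive.
Import Order.TTheory GRing.Theory Num.Theory.
Import numFieldNormedType.Exports.
Local Open Scope classical_set_scope.
Local Open Scope ring_scope.

(* A grid function is an array [v : int -> int -> R].  Only its values at the  *)
(* grid points, 0 <= i <= Nx and 0 <= j <= Ny, and at the ghost points, with   *)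
(* i = -1, i = Nx + 1, j = -1 or j = Ny + 1, are ever used.                    *)
Definition on_grid (Nx Ny : nat) (i j : int) : bool :=
  (0 <= i <= Nx%:Z) && (0 <= j <= Ny%:Z).

Definition neumann (R : realType) (Nx Ny : nat) (v : int -> int -> R) : Prop :=
  [/\ forall j : int, 0 <= j <= Ny%:Z ->
        v (-1) j = v 1 j /\ v (Nx%:Z + 1) j = v (Nx%:Z - 1) j,
      forall i : int, 0 <= i <= Nx%:Z ->
        v i (-1) = v i 1 /\ v i (Ny%:Z + 1) = v i (Ny%:Z - 1)
    & [/\ v (-1) (-1) = v 1 1,
          v (Nx%:Z + 1) (-1) = v (Nx%:Z - 1) 1,
          v (-1) (Ny%:Z + 1) = v 1 (Ny%:Z - 1)
        & v (Nx%:Z + 1) (Ny%:Z + 1) = v (Nx%:Z - 1) (Ny%:Z - 1)]].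

(* Intended for y >= 0. *)
Definition Phi (R : realType) (p y : R) : R :=
  if y == 0 then (if p == 2 then 1 else 0) else y `^ (p - 2).

Definition D0x (R : realType) (h : R) (v : int -> int -> R) (i j : int) : R :=
  (v (i + 1) j - v (i - 1) j) / (2 * h).

Definition D0y (R : realType) (h : R) (v : int -> int -> R) (i j : int) : R :=
  (v i (j + 1) - v i (j - 1)) / (2 * h).

(* [P] is the array of the values Phi_{p,ij}: given by the central differences *)
(* of [v] at the grid points, and by reflection at the ghost points.  The      *)
(* formula is not used at ghost points, where the differences would involve    *)
(* values of [v] two steps outside the grid.                                   *)
Definition is_Phi_array (R : realType) (p h : R) (Nx Ny : nat)
    (v P : int -> int -> R) : Prop :=
  (forall i j, on_grid Nx Ny i j ->
     P i j = Phi p (Num.sqrt (D0x h v i j ^+ 2 + D0y h v i j ^+ 2)))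
  /\ neumann Nx Ny P.

Definition mesh_ratio (R : realType) (phi : R -> R) (k h : R) : R :=
  phi k / h ^+ 2.

(* phi(k) = k + O(k^2) is understood as k -> 0+, phi being a function of time  *)
(* steps k > 0.                                                                *)
Definition denominator_function (R : realType) (phi : R -> R) : Prop :=
  (forall k, 0 < k -> 0 < phi k) /\
  (fun k : R => phi k - k) =O_ (0^'+) (fun k : R => k ^+ 2).

Definition is_Cn (R : realType) (n : nat) (f : R -> R) : Prop :=
  (forall l x, (l < n)%N -> derivable (derive1n l f) x 1) /\
  (forall l, (l <= n)%N -> continuous (derive1n l f)).

(* f^\+ and f^\- are, in the library, fun s => max (f s) 0 and                 *)
(* fun s => max (- f s) 0.                                                     *)
Definition q_minus (R : realType) (phi f : R -> R) (k : R)
    (v : int -> int -> R) (i j : int) : R :=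
  phi k * f^\- (v i j) / v i j.

Definition nsfd_step (R : realType) (lambda k h : R) (phi f : R -> R)
    (Nx Ny : nat) (v P v' : int -> int -> R) : Prop :=
  let r := mesh_ratio phi k h in
  forall i j, on_grid Nx Ny i j ->
    v' i j =
      (v i j
       + lambda * r * (v (i + 1) j * P (i + 1) j + v (i - 1) j * P (i - 1) j
                       + v i (j + 1) * P i (j + 1) + v i (j - 1) * P i (j - 1))
       + phi k * f^\+ (v i j))
      / (1 + q_minus phi f k v i j + 4 * lambda * r * P i j).

(* Main.v *)
(* Reflection extends u > 0 and Phi >= 0 from the grid to the ghost points, so  *)
(* the numerator of the scheme is u_ij > 0 plus nonnegative terms, and the      *)
(* denominator is 1 plus nonnegative terms.                                     *)
Require Import Defs.
From mathcomp Require Import all_boot all_order all_algebra.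
From mathcomp Require Import zify.
From mathcomp Require Import all_classical all_reals all_analysis.
Import Order.TTheory GRing.Theory Num.Theory.
Import numFieldNormedType.Exports.
Local Open Scope classical_set_scope.
Local Open Scope ring_scope.

(** The scheme is explicit, and its only subtraction, the negative part of [f], has been moved into
    the denominator through [q_minus]. So positivity is a matter of signs once [neumann_neighbors]
    controls the four stencil values of [u] and of [Phip]. *)

(** A neighbor off the grid lies one step past an edge, and its mirror image is on the grid because
    each direction has at least one cell. [Q] is abstract to serve both strict positivity of [u] and
    mere nonnegativity of [Phip], which can vanish where the discrete gradient does. *)
Lemma neumann_neighbors {R : realType} {Nx Ny : nat} {v : int -> int -> R}
    (Q : R -> Prop) :
  (0 < Nx)%N -> (0 < Ny)%N -> neumann Nx Ny v ->
  (forall i j, on_grid Nx Ny i j -> Q (v i j)) ->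
  forall i j, on_grid Nx Ny i j ->
  [/\ Q (v (i + 1) j), Q (v (i - 1) j), Q (v i (j + 1)) & Q (v i (j - 1))].
Proof.
rewrite /on_grid => Nx0 Ny0 [vx vy _] Qv i j /andP[hi hj].
have [vx0 vxN] := vx j hj; have [vy0 vyN] := vy i hi.
split.
- have [->|ne] := eqVneq i Nx%:Z; [rewrite vxN|]; apply: Qv; lia.
- have [->|ne] := eqVneq i 0; [rewrite sub0r vx0|]; apply: Qv; lia.
- have [->|ne] := eqVneq j Ny%:Z; [rewrite vyN|]; apply: Qv; lia.
- have [->|ne] := eqVneq j 0; [rewrite sub0r vy0|]; apply: Qv; lia.
Qed.

Lemma Phi_ge0 {R : realType} (p y : R) : 0 <= Phi p y.
Proof. by rewrite /Phi; do 2?case: ifP => _ //; rewrite powR_ge0. Qed.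

Theorem theorem1 (R : realType) (Nx Ny : nat) (p lambda k h L : R)
    (phi f : R -> R) (s m : nat) (u Phip : nat -> int -> int -> R)
    (hNx : (0 < Nx)%N) (hNy : (0 < Ny)%N)
    (hp : 1 < p) (hlambda : 0 < lambda) (hk : 0 < k) (hh : 0 < h)
    (hphi : denominator_function phi)
    (hf_smooth : is_Cn s f)
    (hL : 0 < L) (hf : forall x : R, 0 <= x -> f x <= L * x)
    (hu_neumann : neumann Nx Ny (u m))
    (hPhi : is_Phi_array p h Nx Ny (u m) (Phip m))
    (hscheme : nsfd_step lambda k h phi f Nx Ny (u m) (Phip m) (u m.+1))
    (hu_pos : forall i j : int, on_grid Nx Ny i j -> 0 < u m i j) :
  forall i j : int, on_grid Nx Ny i j -> 0 < u m.+1 i j.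
Proof.
have [phi_pos _] := hphi; have phik := phi_pos k hk.
have r_ge0 : 0 <= lambda * mesh_ratio phi k h.
  by rewrite mulr_ge0 ?(ltW hlambda) // divr_ge0 ?(ltW phik) // sqr_ge0.
have P_ge0 i j : on_grid Nx Ny i j -> 0 <= Phip m i j.
  by move=> hij; rewrite hPhi.1 // Phi_ge0.
move=> i j hij; rewrite hscheme //=.
have [ur ul ut ub] := neumann_neighbors (fun x => 0 < x) hNx hNy hu_neumann hu_pos _ _ hij.
have [Pr Pl Pt Pb] := neumann_neighbors (fun x => 0 <= x) hNx hNy hPhi.2 P_ge0 _ _ hij.
have uij := hu_pos _ _ hij.
rewrite divr_gt0 //.
(* Numerator: strictness comes from [u m i j] alone. *)
- rewrite ltr_wpDr //; first by rewrite mulr_ge0 ?(ltW phik) ?funrpos_ge0.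
  by rewrite ltr_wpDr // mulr_ge0 // !addr_ge0 // mulr_ge0 // ltW.
(* Denominator: strictness comes from the summand 1; the sign of [q_minus] uses that [u m i j] is
   positive. *)
- rewrite ltr_wpDr //; first by rewrite mulr_ge0 ?P_ge0 // -mulrA mulr_ge0.
  by rewrite ltr_wpDr // divr_ge0 ?(ltW uij) // mulr_ge0 ?(ltW phik) ?funrneg_ge0.
Qed.
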